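(* Let $M\ge 1$ and $K\ge 1$ be integers, $R>0$, $\mathbb{P}_{\rm TX}\in[0,1]$, and $\mathbb{P}_K=\frac1K$. Consider the NOMA-assisted grant-free transmission model with $M$ users, $K$ receive SNR levels, target rate $R$, transmission attempt probability $\mathbb{P}_{\rm TX}$ and transmit SNR $P$, and let $P_{j,i}$ be the one-slot transition probabilities of the associated Markov chain with states $s_0,\dots,s_M$ (see context). Then at high SNR, i.e. in the limit $P\to\infty$ with all other parameters fixed, the transition probabilities are given by the following expressions (with the convention $0^0=1$; empty sums are $0$). (i) For $0\le j\le M-1$, $$P_{j,j}\to 1-\sum_{m=1}^{M-j}\binom{M-j}{m}\mathbb{P}_{\rm TX}^m(1-\mathbb{P}_{\rm TX})^{M-j-m}\sum_{k=1}^{K} m\,\mathbb{P}_K(1-k\mathbb{P}_K)^{m-1}.$$ (ii) For $0\le j\le M-2$, $$P_{j,j+1}\to (M-j)\mathbb{P}_{\rm TX}(1-\mathbb{P}_{\rm TX})^{M-j-1}\frac{M-j-1}{M-j}K\mathbb{P}_K$$ $$+\sum_{m=2}^{M-j}\binom{M-j}{m}\mathbb{P}_{\rm TX}^m(1-\mathbb{P}_{\rm TX})^{M-j-m}\sum_{k=1}^{K-1}\frac{M-j-1}{M-j}\,m\,\mathbb{P}_K\left[(1-k\mathbb{P}_K)^{m-1}-\sum_{\kappa=k+1}^{K}(m-1)\mathbb{P}_K(1-\kappa\mathbb{P}_K)^{m-2}\right].$$ (iii) For $0\le j\le M-3$ and $2\le i\le\min\{M-1-j,K\}$, $$P_{j,j+i}\to\binom{M-j}{i}\mathbb{P}_{\rm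 TX}^i(1-\mathbb{P}_{\rm TX})^{M-j-i}\sum_{k_1=1}^{K-i+1}\ \sum_{k_2=k_1+i-1}^{K}\frac{M-j-i}{M-j}\,\mathbb{P}_K^i\binom{k_2-k_1-1}{i-2}\prod_{p=1}^{i}p$$ $$+\sum_{m=i+1}^{M-j}\binom{M-j}{m}\mathbb{P}_{\rm TX}^m(1-\mathbb{P}_{\rm TX})^{M-j-m}\sum_{k_1=1}^{K-i}\ \sum_{k_2=k_1+i-1}^{K-1}\frac{M-j-i}{M-j}\,\mathbb{P}_K^i\binom{k_2-k_1-1}{i-2}\prod_{p=0}^{i-1}(m-p)$$ $$\times\left[(1-k_2\mathbb{P}_K)^{m-i}-\sum_{\kappa=k_2+1}^{K}(m-i)\mathbb{P}_K(1-\kappa\mathbb{P}_K)^{m-i-1}\right].$$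
   Context: Model. $M$ users ${\rm U}_1,\dots,{\rm U}_M$ communicate with one base station over time slots grouped into frames. In each frame every user tries to deliver one update; a user that has succeeded in the frame is silent for the rest of the frame, and the others keep trying. NOMA-assisted random access. The base station preconfigures $K$ receive SNR levels $P_1\ge\dots\ge P_K$ by $P_K=2^R-1$ and $P_k=(2^R-1)(1+(M-1)P_{k+1})$ for $1\le k\le K-1$ (noise power normalized to one), which do not depend on the transmit power budget (transmit SNR) $P$. In each slot, each user that has not yet succeeded in the current frame independently chooses one of the $K$ SNR levels uniformly at random (each with probability $\mathbb{P}_K=1/K$) and independently makes a transmission attempt with probability $\mathbb{P}_{\rm TX}$. Channel gains $h$ are i.i.d. (across users and slots) complex Gaussian with zero mean and unit variance. Level $P_k$ is infeasible for a user with channel gain $h$ if $P_k/|h|^2>P$; the user's update then fails in that slot. (Whether such a user still interferes with others is immaterial here, because only the limit $P\to\infty$ is considered, in which each level is feasible with probability tending to one.) The base station performs successive interference cancellation (SIC), processing the levels in the order $P_1,P_2,\dots,P_K$. If exactly one user transmits at level $P_k$ (with the level feasible), and SIC has not been terminated at an earlier level, that user succeeds. If two or more users transmit at level $P_k$, a collision occurs, all of them fail, and SIC terminates, so that all users transmitting at levels $P_i$, $i>k$, also fail. If no user transmits at a level, SIC simply proceeds to the next level. Markov chain. The tagged user is ${\rm U}_1$. For $0\le k\le M-1$, state $s_k$ means that ${\rm U}_1$ has not yet succeeded in the current frame and exactly $k$ of the other users have succeeded (so $M-k$ users, including ${\rm U}_1$, remain). State $s_M$ means that ${\rm U}_1$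 has succeeded. $P_{j,i}$ is the probability of moving from $s_j$ to $s_i$ in one time slot. Thus, for $j+i\le M-1$, $P_{j,j+i}$ with $i\geq 1$ is the probability that exactly $i$ users succeed in the slot, none of which is ${\rm U}_1$, and $P_{j,j}$ is the probability that no user succeeds. *)

(* Defs.v *)
From HB Require Import structures.
From mathcomp Require Import all_boot all_order all_algebra.
From mathcomp Require Import all_classical all_reals all_analysis.

Set Implicit Arguments.
Unset Strict Implicit.
Unset Printing Implicit Defensive.
Import Order.TTheory GRing.Theory Num.Theory numFieldNormedType.Exports.

Local Open Scope classical_set_scope.
Local Open Scope ring_scope.

(* Receive SNR levels are numbered 1, ..., K as naturals; users are 'I_M, and
   U_1 is the user of index 0. *)
Section NomaSlot.
Context {R : realType}.
Variables (M K : nat) (rate : R).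

(* [snr_rec n] is P_{K-n}. *)
Fixpoint snr_rec (n : nat) : R :=
  if n is n'.+1 then (2 `^ rate - 1) * (1 + (M%:R - 1) * snr_rec n')
  else 2 `^ rate - 1.

Definition snr_level (k : nat) : R := snr_rec (K - k).

(* A complex gain h is the pair (Re h, Im h). *)
Definition gain_sq (h : R * R) : R := h.1 ^+ 2 + h.2 ^+ 2.

(* P_k / |h|^2 > P, with the division cleared so that every level is
   infeasible when h = 0 (in MathComp x / 0 = 0). *)
Definition infeasible (P : R) (h : R * R) (k : nat) : bool :=
  P * gain_sq h < snr_level k.

Section Realization.
(* [silent]: whether a user for which the chosen level is infeasible stays
   silent, or else occupies (hence interferes at) that level.  The model leaves
   this open; in both cases the user itself fails.
   [D] is the set of the users that have already succeeded in the frame. *)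
Variables (silent : bool) (P : R) (D : {set 'I_M}).
Variables (gain : 'I_M -> R * R) (level : 'I_M -> nat) (attempt : 'I_M -> bool).

Definition transmitters (k : nat) : {set 'I_M} :=
  [set u | [&& u \notin D, attempt u, level u == k
             & silent ==> ~~ infeasible P (gain u) k]]%SET.

Definition succeeds (u : 'I_M) : bool :=
  [&& (1 <= level u <= K)%N,
      ~~ infeasible P (gain u) (level u),
      transmitters (level u) == [set u]%SET
    & all (fun k => #|transmitters k| <= 1)%N (index_iota 1 (level u))].

Definition next_succeeded : {set 'I_M} := D :|: [set u | succeeds u]%SET.

End Realization.

(* Index of the chain state: M if U_1 has succeeded, and otherwise the number
   of users that have succeeded. *)
Definition chain_state (hM : (0 < M)%N) (D : {set 'I_M}) : nat :=
  if Ordinal hM \in D then M else #|D|.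

(* Probability of moving in one slot to s_i when the set of succeeded users
   is D; for [chain_state hM D = j] this is P_{j,i}. *)
Definition trans_prob {d : measure_display} {Omega : measurableType d}
    (Pr : probability Omega R) (hM : (0 < M)%N) (silent : bool)
    (gain : 'I_M -> {RV Pr >-> (R * R)%type})
    (level : 'I_M -> {RV Pr >-> nat}) (attempt : 'I_M -> {RV Pr >-> bool})
    (P : R) (D : {set 'I_M}) (i : nat) : \bar R :=
  Pr [set w | chain_state hM
                (next_succeeded silent P D (gain ^~ w) (level ^~ w)
                   (attempt ^~ w)) = i].

End NomaSlot.

(* Circularly symmetric complex Gaussian law with E h = 0 and E |h|^2 = 1:
   independent N(0, 1/2) real and imaginary parts. *)
Definition complex_gaussian {R : realType} : set (R * R)%type -> \bar R :=
  (normal_prob (0 : R) (Num.sqrt 2^-1) \x normal_prob (0 : R) (Num.sqrt 2^-1))%E.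

(* Mutual independence of the 3M variables gain_u, level_u, attempt_u.  The
   family being finite, the product rule over subfamilies is the case where the
   other sets are the whole space. *)
Definition slot_independent {R : realType} {d : measure_display}
    {Omega : measurableType d} (Pr : probability Omega R) (M : nat)
    (gain : 'I_M -> {RV Pr >-> (R * R)%type})
    (level : 'I_M -> {RV Pr >-> nat}) (attempt : 'I_M -> {RV Pr >-> bool}) :=
  forall (A : 'I_M -> set (R * R)%type) (B : 'I_M -> set nat)
         (C : 'I_M -> set bool),
    (forall u, measurable (A u)) ->
    Pr (\bigcap_(u in [set: 'I_M])
          (gain u @^-1` A u `&` level u @^-1` B u `&` attempt u @^-1` C u)) =
    (\prod_(u < M) (Pr (gain u @^-1` A u) * Pr (level u @^-1` B u)
                    * Pr (attempt u @^-1` C u)))%E.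

(* Main.v *)
Require Import Defs.
From HB Require Import structures.
From mathcomp Require Import all_boot all_order all_algebra zify ring.

Set Implicit Arguments.
Unset Strict Implicit.
Unset Printing Implicit Defensive.
Import Order.TTheory GRing.Theory Num.Theory.

Local Open Scope ring_scope.

(* Only the lowest occupied level matters: if it holds a single user, that user
   is decoded and SIC restarts with the other users above that level; otherwise
   nothing is decoded.  Let a user be idle with probability 1 - P_TX and
   otherwise occupy each level with probability p = P_TX P_K.  By induction on
   i, a prescribed set of i out of n users is the decoded set with probability
   i! p^i sum_l C(l - 1, i - 1) s(n - i, l), where l is the level of the last
   decoded user and s(n', l) is the probability that n' users all avoid the
   levels 1..l and that none of them is decoded.  Conditioning on the number m
   of transmitting users (the binomial theorem, applied to s) turns this into
   the stated sums, and U_1 is not decoded for C(N - 1, i) of the sets.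
   Finally |h|^2 > 0 almost surely, so the probability that some level is
   infeasible vanishes as P tends to infinity. *)

(** * Hockey-stick identities for binomial coefficients *)

Lemma hockey_stick_col (k n r : nat) : (k < n)%N ->
  (\sum_(k.+1 <= l < n) 'C(n - l - 1, r) = 'C(n - k - 1, r.+1))%N.
Proof.
move=> /subnKC; move: (n - k.+1)%N => e <-; elim: e k => [|e IH] k.
  by rewrite addn0 big_geq // subSn // subnn subn1.
rewrite big_ltn ?addnS ?ltnS ?leq_addr // -addSn IH.
have -> : (k.+2 + e - k.+1 - 1 = e)%N by lia.
have -> : (k.+2 + e - k - 1 = e.+1)%N by lia.
by rewrite binS addnC.
Qed.

(** Sums out the lower level [k1]: in the induction on [n], the coefficients of the new value
    [k2 = n] are summed by [hockey_stick_col]. *)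
Lemma hockey_stick (R : nmodType) (k n r : nat) (X : nat -> R) :
  \sum_(k.+1 <= k1 < n) \sum_(k1.+1 <= k2 < n) X k2 *+ 'C(k2 - k1 - 1, r) =
  \sum_(k.+1 <= k2 < n) X k2 *+ 'C(k2 - k - 1, r.+1).
Proof.
elim: n => [|n IH]; first by rewrite !big_geq.
have [kn|nk] := leqP k.+1 n; last by rewrite !big_geq.
rewrite [in LHS]big_nat_recr //= [in RHS]big_nat_recr //= -IH.
rewrite [X in _ + X = _]big_geq // addr0.
rewrite -hockey_stick_col // -sumrMnr -big_split /=.
apply: eq_big_nat => k1 /andP[_ k1n].
by rewrite big_nat_recr.
Qed.

(** * SIC decoding of a fixed assignment of levels *)

Section Decoding.
Variables (T : finType) (K : nat).
Implicit Types (g : {ffun T -> 'I_K.+1}) (s u : T) (A S : {set T}).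

(* [g u] is the level occupied by [u], with 0 for an idle user. *)
Definition decoded g : {set T} :=
  [set u | (0 < g u)%N && [forall v, forall v',
    [&& (0 < g v)%N, (g v <= g u)%N & g v' == g v] ==> (v' == v)]].

Definition lowest g s : bool :=
  (0 < g s)%N && [forall u, (u != s) ==> (g u == ord0) || (g s < g u)%N].

Definition upd s (l : 'I_K.+1) g : {ffun T -> 'I_K.+1} :=
  [ffun u => if u == s then l else g u].

Lemma decodedP g u :
  reflect ((0 < g u)%N /\
    forall v v', (0 < g v)%N -> (g v <= g u)%N -> g v' = g v -> v' = v)
    (u \in decoded g).
Proof.
rewrite inE; apply: (iffP andP) => -[gu H]; split=> //.
  move=> v v' v0 vu vv'; apply/eqP.
  by move/forallP/(_ v)/forallP/(_ v'): H; rewrite v0 vu vv' eqxx.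
apply/forallP => v; apply/forallP => v'; apply/implyP => /and3P[v0 vu /eqP vv'].
by apply/eqP/H.
Qed.

Lemma lowestP g s :
  reflect ((0 < g s)%N /\
    forall u, u != s -> (0 < g u)%N -> (g s < g u)%N) (lowest g s).
Proof.
apply: (iffP andP) => -[gs H]; split=> //.
  move=> u us u0; move/forallP/(_ u): H; rewrite us -val_eqE /=.
  by rewrite eqn0Ngt u0.
apply/forallP => u; apply/implyP => us; rewrite -val_eqE /= eqn0Ngt.
by case: (posnP (g u)) => //= u0; apply: H.
Qed.

Lemma lowest_uniq g s s' : lowest g s -> lowest g s' -> s = s'.
Proof.
move=> /lowestP[s0 H] /lowestP[s0' H']; apply/eqP; apply/negPn/negP => ne.
have := H _ _ s0'; rewrite eq_sym => /(_ ne) lt1.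
by have := ltn_trans lt1 (H' _ ne s0); rewrite ltnn.
Qed.

(** A user alone on the lowest occupied level never stops SIC, so making it idle changes the fate of
    no other user. *)
Lemma decoded_lowest g s :
  lowest g s -> decoded g = s |: decoded (upd s ord0 g).
Proof.
move=> /lowestP[s0 H]; apply/setP => u; rewrite in_setU1.
have [->|us] := eqVneq u s.
  apply/decodedP; split=> // v v' v0 vs vv'.
  have vE : v = s.
    by apply/eqP; apply: contraTT vs => ne; rewrite -ltnNge H.
  rewrite {}vE in v0 vs vv' *.
  apply/eqP; apply/negPn/negP => ne; have := H _ ne.
  by rewrite vv' => /(_ s0); rewrite ltnn.
rewrite /=; apply/decodedP/decodedP; rewrite ffunE (negbTE us) => -[u0 D].
  split=> // v v'; rewrite !ffunE; case: (eqVneq v s) => //= vs v0 vu.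
  case: eqVneq => //= v's; last exact: D.
  by move=> v0'; rewrite -v0' in v0.
split=> // v v' v0 vu vv'; have [vE|vs] := eqVneq v s.
  apply/eqP; apply/negPn/negP => ne; rewrite vE in ne vv'.
  by have := H _ ne; rewrite vv' => /(_ s0); rewrite ltnn.
have [v'E|v's] := eqVneq v' s.
  by have := H _ vs v0; rewrite -vv' v'E ltnn.
by apply: D; rewrite ?ffunE ?(negbTE vs) ?(negbTE v's).
Qed.

(** If some user is decoded, every occupied level up to its own holds a single user, so a user of
    minimal positive level is alone there. *)
Lemma decoded_eq0 g : (decoded g == set0) = ~~ [exists s, lowest g s].
Proof.
apply/eqP/existsPn => [D0 s|noL].
  by apply/negP => /decoded_lowest; rewrite D0 => /setP/(_ s); rewrite !inE eqxx.
apply/setP => u; rewrite [RHS]in_set0; apply/negP => /decodedP[u0 D].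
case: (@arg_minnP T u (fun v => 0 < g v)%N (fun v => g v : nat) u0) => s s0 H.
move/negP: (noL s); apply; apply/lowestP; split=> // v vs v0.
rewrite ltn_neqAle H // andbT eq_sym; apply/negP => /eqP E.
by move/eqP: vs; apply; apply: D => //; [exact: H|exact/val_inj].
Qed.

(** Turns an indicator into a sum over users, which allows conditioning on the first decoded
    user. *)
Lemma sum_lowest (R : pzSemiRingType) g :
  \sum_s (lowest g s)%:R = (decoded g != set0)%:R :> R.
Proof.
rewrite decoded_eq0 negbK; case: existsP => [[s Ls]|noL] /=.
  rewrite (bigD1 s) //= Ls big1 ?addr0 // => s' ne.
  by case: (boolP (lowest g s')) => // /(lowest_uniq Ls) E; rewrite E eqxx in ne.
by rewrite big1 // => s _; case: (boolP (lowest g s)) => // Ls; case: noL; exists s.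
Qed.

(** * Mass of the assignments with a prescribed decoded set *)

Section Mass.
Variables (R : comPzRingType) (p q : R).
Hypothesis pq1 : q + p *+ K = 1.

(* The users outside [A] are idle; those in [A] avoid the levels 1..k. *)
Definition wt A (k : nat) u (v : 'I_K.+1) : R :=
  if u \in A then (if v == ord0 then q else if (k < v)%N then p else 0)
  else (v == ord0)%:R.

Definition mass A k g : R := \prod_u wt A k u (g u).

Lemma mass_total A k : (k <= K)%N ->
  \sum_g mass A k g = (1 - p *+ k) ^+ #|A|.
Proof.
move=> kK; rewrite /mass -(bigA_distr_bigA (wt A k)) (bigID (mem A)) /=.
rewrite [X in _ * X]big1 ?mulr1 => [|u uA].
  rewrite -prodr_const; apply: eq_bigr => u uA.
  rewrite /wt uA big_ord_recl eqxx /=.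
  have -> : \sum_(i < K) (if (k < lift ord0 i)%N then p else 0) = p *+ (K - k).
    rewrite -big_mkcond /= sumr_const; congr (_ *+ _).
    rewrite -sum1_card -(big_mkord (fun i => (k <= i)%N) (fun=> 1%N)).
    rewrite (big_cat_nat (leq0n k) kK) /= big_nat_cond big_pred0 => [|i]; last first.
      by apply/negP => /andP[/andP[_]]; rewrite ltnNge => /negP.
    rewrite big_nat_cond (eq_bigl (fun i => (k <= i < K)%N)); last first.
      by move=> i; case: (k <= i)%N; rewrite ?andbF ?andbT.
    by rewrite add0n -big_nat sum_nat_const_nat muln1.
  by rewrite -pq1 mulrnBr // addrA.
rewrite /wt (negbTE uA) (bigD1 ord0) //= big1 ?addr0 // => i /negbTE.
by move=> ->.
Qed.

(** Taking [s] off level [l] costs a factor [p]. That all others are idle or above [l] is what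
    [mass (A :\ s) l] enforces: the barrier rises from [k] to [l]. *)
Lemma mass_lowest A k s (l : 'I_K.+1) (Phi : {ffun T -> 'I_K.+1} -> R) :
  (0 < l)%N ->
  \sum_(g | lowest g s && (g s == l)) Phi (upd s ord0 g) * mass A k g =
  if (s \in A) && (k < l)%N
  then p * \sum_g Phi g * mass (A :\ s) l g else 0.
Proof.
move=> l0; have l0F : (l == ord0) = false by rewrite -val_eqE /= eqn0Ngt l0.
case: ifP => [/andP[sA kl]|sAkl]; last first.
  rewrite big1 // => g /andP[_ /eqP gs].
  rewrite /mass (bigD1 s) //= gs /wt l0F; move: sAkl.
  by case: (s \in A) => //= [->|_]; rewrite mul0r mulr0.
rewrite (reindex_onto (upd s l) (upd s ord0)) /=; last first.
  move=> g /andP[_ /eqP gs]; apply/ffunP => u; rewrite !ffunE.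
  by case: eqVneq => // ->.
rewrite big_distrr /= big_mkcond /=; apply: eq_bigr => g _.
have updE : upd s ord0 (upd s l g) = upd s ord0 g.
  by apply/ffunP => u; rewrite !ffunE; case: eqP.
rewrite updE.
have [gs|gs] := eqVneq (g s) ord0; last first.
  rewrite [in RHS]/mass (bigD1 s) //= /wt setD11 (negbTE gs) mul0r !mulr0.
  case: ifP => // /andP[_ /eqP/ffunP/(_ s)]; rewrite ffunE eqxx => E.
  by rewrite -E eqxx in gs.
have gE : upd s ord0 g = g.
  by apply/ffunP => u; rewrite !ffunE; case: eqVneq => // ->.
rewrite gE eqxx andbT ffunE eqxx eqxx andbT.
case: ifPn => [/lowestP[_ H]|nH].
  rewrite mulrCA; congr (_ * _).
  rewrite /mass (bigD1 s) //= [in RHS](bigD1 s) //= /wt sA setD11 ffunE eqxx l0F kl gs eqxx mul1r.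
  congr (_ * _); apply: eq_bigr => u us; rewrite !ffunE !inE us (negbTE us) /=.
  case: eqVneq => // gu; have := H u us; rewrite !ffunE eqxx (negbTE us) lt0n => /(_ gu) lg.
  by rewrite lg (ltn_trans kl lg).
(* A user that keeps [s] from being lowest sits on one of the levels 1..l, so its weight is zero on
   the right-hand side. *)
have [u [us gu lu]] : exists u, [/\ u != s, g u != ord0 & ~~ (l < g u)%N].
  move: nH; rewrite /lowest ffunE eqxx l0 /= => /forallPn[u].
  by rewrite negb_imply ffunE negb_or => /and3P[us]; rewrite (negbTE us); exists u.
rewrite [in RHS]/mass (bigD1 u) //= /wt (negbTE gu) (negbTE lu).
by rewrite if_same mul0r !mulr0.
Qed.

Lemma mass_not_subset A k g : ~~ (decoded g \subset A) -> mass A k g = 0.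
Proof.
move=> /subsetPn[u /decodedP[u0 _] uA].
by rewrite /mass (bigD1 u) //= /wt (negbTE uA) -val_eqE /= eqn0Ngt u0 mul0r.
Qed.

(* Probability that [n] users all avoid the levels 1..k and none is decoded:
   subtract the cases where the lowest occupied level l holds a single user. *)
Definition stuck (n k : nat) : R :=
  (1 - p *+ k) ^+ n - \sum_(k.+1 <= l < K.+1) (p * (1 - p *+ l) ^+ n.-1) *+ n.

(** One round of SIC, split by the level of the first decoded user; [Phi] is an arbitrary function
    of the configuration left behind. *)
Lemma sum_lowest_level A k s (Phi : {ffun T -> 'I_K.+1} -> R) : s \in A ->
  \sum_g (lowest g s)%:R * (Phi (upd s ord0 g) * mass A k g) =
  \sum_(k.+1 <= l < K.+1) p * \sum_g Phi g * mass (A :\ s) l g.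
Proof.
move=> sA.
have -> : \sum_g (lowest g s)%:R * (Phi (upd s ord0 g) * mass A k g) =
   \sum_(l < K.+1) \sum_(g | lowest g s && (g s == l)) Phi (upd s ord0 g) * mass A k g.
  rewrite (eq_bigr (fun g => if lowest g s then Phi (upd s ord0 g) * mass A k g else 0)).
    by rewrite -big_mkcond /= (partition_big (fun g => g s) xpredT).
  by move=> g _; case: ifP => _; rewrite ?mul1r ?mul0r.
rewrite (big_nat_widenl _ 0) // big_mkord [RHS]big_mkcond /=.
apply: eq_bigr => l _.
case: (posnP l) => [l0|l0]; last by rewrite mass_lowest // sA; case: ltnP.
rewrite l0 ltn0 big1 // => g /andP[/lowestP[g0] _ /eqP E].
by rewrite E l0 in g0.
Qed.

(** The events that a given user is lowest are disjoint, so their masses are subtracted from the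
    total without inclusion-exclusion. *)
Lemma mass_decoded0 A k : (k <= K)%N ->
  \sum_(g | decoded g == set0) mass A k g = stuck #|A| k.
Proof.
move=> kK; rewrite /stuck -mass_total //.
have -> : \sum_(g | decoded g == set0) mass A k g =
   \sum_g mass A k g - \sum_s \sum_g (lowest g s)%:R * mass A k g.
  rewrite exchange_big /= -sumrB big_mkcond; apply: eq_bigr => g _.
  rewrite -mulr_suml sum_lowest; case: eqP => _ /=; rewrite ?mul0r ?subr0 //.
  by rewrite mul1r subrr.
congr (_ - _); rewrite (bigID (mem A)) /= [X in _ + X]big1 ?addr0 => [|s sA].
  rewrite (eq_bigr (fun=> \sum_(k.+1 <= l < K.+1) p * (1 - p *+ l) ^+ #|A|.-1)).
    by rewrite sumr_const -sumrMnl.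
  move=> s sA.
  rewrite (eq_bigr (fun g => (lowest g s)%:R * (1 * mass A k g))); last first.
    by move=> g _; rewrite mul1r.
  rewrite (sum_lowest_level k (fun=> 1)) //; apply: eq_big_nat => l /andP[_ lK].
  under eq_bigr do rewrite mul1r.
  by rewrite mass_total // (cardsD1 s A) sA.
rewrite big1 // => g _; case: (boolP (lowest g s)) => [Ls|]; last by rewrite mul0r.
rewrite mass_not_subset ?mulr0 //; apply/subsetPn; exists s => //.
by rewrite (decoded_lowest Ls) setU11.
Qed.

Lemma mass_decoded_rec A S k : S \subset A -> S != set0 ->
  \sum_(g | decoded g == S) mass A k g =
  \sum_(s in S) \sum_(k.+1 <= l < K.+1)
     p * \sum_(g | decoded g == S :\ s) mass (A :\ s) l g.
Proof.
move=> SA S0.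
have -> : \sum_(g | decoded g == S) mass A k g =
  \sum_s \sum_g (lowest g s)%:R * ((decoded g == S)%:R * mass A k g).
  rewrite exchange_big /= big_mkcond; apply: eq_bigr => g _.
  rewrite -mulr_suml sum_lowest; case: eqP => [->|_] /=; last by rewrite mul0r mulr0.
  by rewrite S0 !mul1r.
rewrite [RHS]big_mkcond; apply: eq_bigr => s _; case: ifPn => sS; last first.
  rewrite big1 // => g _; case: (boolP (lowest g s)) => [Ls|]; last by rewrite mul0r.
  case: eqP => [E|]; last by rewrite mul0r mulr0.
  by rewrite -E (decoded_lowest Ls) setU11 in sS.
rewrite (eq_bigr (fun g => (lowest g s)%:R *
   ((decoded (upd s ord0 g) == S :\ s)%:R * mass A k g))); last first.
  move=> g _; case: (boolP (lowest g s)) => [Ls|]; last by rewrite !mul0r.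
  rewrite (decoded_lowest Ls); congr (_ * (_%:R * _)).
  congr nat_of_bool; apply/idP/idP => /eqP E; last by rewrite E setD1K.
  rewrite -E setU1K //; apply/negP => /decodedP[]; by rewrite ffunE eqxx.
rewrite (sum_lowest_level k (fun g => (decoded g == S :\ s)%:R)) ?(subsetP SA) //.
apply: eq_bigr => l _; congr (_ * _); rewrite [RHS]big_mkcond /=.
by apply: eq_bigr => g _; case: ifP => _; rewrite ?mul1r ?mul0r.
Qed.

(** The factorial counts the orders in which [S] is decoded; the binomial places the first [i]
    decoded levels strictly between [k] and the last one, [l]. *)
Lemma mass_decoded A S k i : S \subset A -> #|S| = i.+1 ->
  \sum_(g | decoded g == S) mass A k g =
  p ^+ i.+1 * (\sum_(k.+1 <= l < K.+1)
                 stuck (#|A| - i.+1) l *+ 'C(l - k - 1, i)) *+ (i.+1)`!.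
Proof.
elim: i A S k => [|i IH] A S k SA cS.
  have [s ES] : exists s, S = [set s] by apply/cards1P; rewrite cS.
  have sA : s \in A by rewrite (subsetP SA) // ES set11.
  rewrite mass_decoded_rec ?ES ?big_set1 ?sub1set //; last first.
    by apply/set0Pn; exists s; rewrite set11.
  rewrite mulr_sumr; apply: eq_big_nat => l /andP[_ lK].
  rewrite setDv mass_decoded0 // bin0 expr1; congr (_ * stuck _ _).
  by rewrite (cardsD1 s A) sA subSS subn0.
rewrite mass_decoded_rec -?card_gt0 ?cS //.
(* Each of the [i.+2] choices of the first decoded user contributes the same mass; [hockey_stick]
   sums out its level. *)
rewrite (eq_bigr (fun=> p ^+ i.+2 * (\sum_(k.+1 <= l < K.+1)
   stuck (#|A| - i.+2) l *+ 'C(l - k - 1, i.+1)) *+ (i.+1)`!)).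
  by rewrite sumr_const cS -mulrnA mulnC -factS.
move=> s sS.
rewrite -hockey_stick mulr_sumr -sumrMnl; apply: eq_big_nat => l /andP[_ lK].
rewrite IH ?setSD //; last by move: cS; rewrite (cardsD1 s S) sS => -[].
have -> : (#|A :\ s| - i.+1 = #|A| - i.+2)%N.
  by rewrite (cardsD1 s A) (subsetP SA) // subSS.
by rewrite -mulrnAr mulrA -exprS mulrnAr.
Qed.

Lemma mass_card_decoded0 A z : z \in A ->
  \sum_(g | (z \notin decoded g) && (#|decoded g| == 0%N)) mass A 0 g =
  stuck #|A| 0.
Proof.
move=> zA; rewrite -mass_decoded0 //; apply: eq_bigl => g.
by rewrite cards_eq0; case: eqP => [->|]; rewrite ?andbF ?inE.
Qed.

(** The mass of a decoded set depends only on its size, and ['C(#|A|.-1, i.+1)] subsets of [A] of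
    that size avoid [z]. *)
Lemma mass_card_decoded A z i : z \in A ->
  \sum_(g | (z \notin decoded g) && (#|decoded g| == i.+1)) mass A 0 g =
  p ^+ i.+1 * (\sum_(1 <= l < K.+1) stuck (#|A| - i.+1) l *+ 'C(l.-1, i))
    *+ ((i.+1)`! * 'C(#|A|.-1, i.+1)).
Proof.
move=> zA.
pose D := [set S : {set T} | S \subset A :\ z & #|S| == i.+1].
rewrite (bigID (fun g => decoded g \subset A)) /= [X in _ + X]big1 ?addr0; last first.
  by move=> g /andP[_]; exact: mass_not_subset.
rewrite (partition_big (fun g => decoded g) (mem D)) /=; last first.
  by move=> g /andP[/andP[zg cg] gA]; rewrite inE subsetD1 gA zg.
have -> : 'C(#|A|.-1, i.+1) = #|D|.
  by rewrite cards_draws (cardsD1 z A) zA.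
rewrite mulrnA -sumr_const; apply: eq_bigr => S; rewrite inE subsetD1.
move=> /andP[/andP[SA zS] /eqP cS].
rewrite (eq_big_nat _ _ (F2 := fun l => stuck (#|A| - i.+1) l *+ 'C(l - 0 - 1, i))).
  rewrite -(mass_decoded _ SA cS); apply: eq_bigl => g.
  case: (eqVneq (decoded g) S) => [->|_]; rewrite ?andbF //.
  by rewrite zS SA cS eqxx.
by move=> l _; rewrite subn0 subn1.
Qed.

End Mass.
End Decoding.

(** * Binomial identities, thinning and change of summation indices *)

Lemma mul_bin_trinomial n m i : (i <= m)%N ->
  ('C(n, m) * 'C(m, i) = 'C(n, i) * 'C(n - i, m - i))%N.
Proof.
move=> im; have [mn|nm] := leqP m n; last first.
  have [ni|iN] := ltnP n i; first by rewrite (bin_small nm) (bin_small ni).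
  by rewrite (bin_small nm) (@bin_small (n - i)) ?muln0 //; lia.
have : ('C(n, m) * 'C(m, i) * (i`! * (m - i)`! * (n - m)`!) =
        'C(n, i) * 'C(n - i, m - i) * (i`! * (m - i)`! * (n - m)`!))%N.
  have E1 := bin_fact mn; have E2 := bin_fact im.
  have E3 := bin_fact (leq_trans im mn).
  have E4 : ('C(n - i, m - i) * ((m - i)`! * (n - m)`!) = (n - i)`!)%N.
    have <- : (n - i - (m - i) = n - m)%N by lia.
    by rewrite bin_fact // leq_sub2r.
  transitivity ('C(n, m) * (('C(m, i) * (i`! * (m - i)`!)) * (n - m)`!))%N; first by ring.
  rewrite E2 E1 -E3 -E4; ring.
by move=> /eqP; rewrite eqn_pmul2r ?muln_gt0 ?fact_gt0 //= => /eqP.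
Qed.

(** Source of the factor (n - i) / n, the proportion of [i]-sets that miss the tagged user; it is
    kept free of division. *)
Lemma mul_bin_pred_trinomial n m i : (i <= m)%N ->
  (n * (i`! * 'C(n.-1, i) * 'C(n - i, m - i)) =
   (n - i) * ('C(n, m) * m ^_ i))%N.
Proof.
move=> im; rewrite -bin_ffact (mulnA 'C(n, m)) mul_bin_trinomial //.
have := mul_bin_down n i; move: 'C(n.-1, i) 'C(n, i) => a b E.
transitivity (i`! * (n * a) * 'C(n - i, m - i))%N; first by ring.
rewrite E; ring.
Qed.

Lemma stuck0 (K : nat) (R : comPzRingType) (p : R) k : stuck K p 0 k = 1.
Proof. by rewrite /stuck big1 ?subr0. Qed.

(** When every user transmits, none can avoid all [K] levels. This is why the last decoded level
    stops at K - 1 once an undecoded transmitter remains. *)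
Lemma stuck_top (K : nat) (R : comPzRingType) (p : R) n :
  p *+ K = 1 -> (0 < n)%N -> stuck K p n K = 0.
Proof. by case: n => // n pK1 _; rewrite /stuck pK1 subrr expr0n big_geq // subr0. Qed.

Lemma stuckE (K : nat) (R : comPzRingType) (p : R) n k :
  stuck K p n k = (1 - k%:R * p) ^+ n
    - \sum_(k.+1 <= l < K.+1) n%:R * p * (1 - l%:R * p) ^+ (n - 1).
Proof.
rewrite /stuck mulr_natl subn1; congr (_ - _); apply: eq_bigr => l _.
by rewrite !mulr_natl mulrnAl.
Qed.

(* Each of the [n] users transmits with probability [t], independently. *)
Lemma stuck_thinning (K : nat) (R : comPzRingType) (t c : R) (n k : nat) :
  stuck K (t * c) n k =
  \sum_(m < n.+1) t ^+ m * (1 - t) ^+ (n - m) * stuck K c m k *+ 'C(n, m).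
Proof.
(* A user avoids the levels 1..l by being idle or by transmitting above [l]. *)
have bin (l j : nat) : (1 - (t * c) *+ l) ^+ j =
    \sum_(m < j.+1) t ^+ m * (1 - t) ^+ (j - m) * (1 - c *+ l) ^+ m *+ 'C(j, m).
  have -> : 1 - (t * c) *+ l = (1 - t) + t * (1 - c *+ l).
    by rewrite mulrBr mulr1 mulrnAr addrA subrK.
  by rewrite exprDn; apply: eq_bigr => m _; rewrite exprMn mulrA [_ * t ^+ m]mulrC.
rewrite /stuck; under [RHS]eq_bigr do rewrite mulrBr mulrnBl.
rewrite sumrB -bin; congr (_ - _).
under [RHS]eq_bigr do rewrite mulr_sumr -sumrMnl.
rewrite exchange_big /=; apply: eq_bigr => l _.
rewrite big_ord_recl !mulr0n mulr0 mul0rn add0r.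
case: n => [|n]; first by rewrite big_ord0 mulr0n.
rewrite bin mulr_sumr -sumrMnl; apply: eq_bigr => m _.
rewrite lift0 subSS /= !mulrnAr -!mulrnA -mul_bin_diag mulnC.
congr (_ *+ _); rewrite exprS; ring.
Qed.

(** [k1] and [k2] are the first and last decoded levels, with i - 2 others between them. The ranges
    on the left omit only zero binomials, and [hockey_stick] sums out [k1]. *)
Lemma sum_two_levels (R : nmodType) (i n : nat) (X : nat -> R) : (2 <= i <= n)%N ->
  \sum_(1 <= k1 < (n - i).+1) \sum_(k1 + i - 1 <= k2 < n)
     X k2 *+ 'C(k2 - k1 - 1, i - 2) =
  \sum_(1 <= l < n) X l *+ 'C(l.-1, i.-1).
Proof.
move=> /andP[i2 iN].
transitivity (\sum_(1 <= k1 < n) \sum_(k1.+1 <= k2 < n)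
     X k2 *+ 'C(k2 - k1 - 1, i - 2)).
  rewrite [RHS](big_cat_nat (n := (n - i).+1)) //=; last by lia.
  rewrite [X in _ + X]big_nat_cond [X in _ + X]big1 ?addr0.
    apply: eq_big_nat => k1 /andP[k1_gt0 k1n].
    rewrite [RHS](big_cat_nat (n := (k1 + i - 1)%N)) /=; [|lia|lia].
    rewrite [X in _ = X + _]big_nat_cond [X in _ = X + _]big1 ?add0r //.
    move=> k2 /andP[/andP[? ?] _].
    by rewrite bin_small //; lia.
  move=> k1 /andP[/andP[? ?] _]; rewrite big_nat_cond big1 // => k2 /andP[/andP[? ?] _].
  by rewrite bin_small //; lia.
rewrite hockey_stick; apply: eq_big_nat => l _.
by rewrite subn0 subn1; congr (_ *+ 'C(_, _)); lia.
Qed.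

(** * Law of the number of decoded users *)

Section Law.
Variables (T : finType) (K : nat) (R : numFieldType) (t c : R).
Hypothesis Kc1 : c *+ K = 1.

Let pq1 : (1 - t) + (t * c) *+ K = 1.
Proof. by rewrite -mulrnAr Kc1 mulr1 subrK. Qed.

Lemma decoded0_law (A : {set T}) z : z \in A ->
  \sum_(g : {ffun T -> 'I_K.+1} | (z \notin decoded g) && (#|decoded g| == 0%N))
    mass (t * c) (1 - t) A 0 g =
  1 - \sum_(1 <= m < #|A|.+1) 'C(#|A|, m)%:R * t ^+ m * (1 - t) ^+ (#|A| - m)
      * \sum_(1 <= k < K.+1) m%:R * c * (1 - k%:R * c) ^+ (m - 1).
Proof.
move=> zA; rewrite (mass_card_decoded0 pq1) // stuck_thinning /stuck.
under eq_bigr do rewrite mulr0n subr0 expr1n mulrBr mulr1 mulrnBl.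
rewrite sumrB; congr (_ - _).
  transitivity (((1 - t) + t) ^+ #|A|); last by rewrite subrK expr1n.
  by rewrite exprDn; apply: eq_bigr => m _; rewrite mulrC.
rewrite big_ord_recl (eq_bigr (fun=> 0)) => [|l _]; last by rewrite mulr0n.
rewrite big1 // mulr0 mul0rn add0r big_add1 /= big_mkord; apply: eq_bigr => m _.
rewrite -[bump 0 m]/(m.+1) -[LHS]mulr_natl !mulrA; congr (_ * _).
apply: eq_bigr => l _; rewrite -mulr_natl mulrA subn1 /=.
by rewrite -[c *+ l]mulr_natl.
Qed.

Lemma decoded_law (A : {set T}) z i : z \in A -> (0 < i <= #|A|)%N ->
  \sum_(g : {ffun T -> 'I_K.+1} | (z \notin decoded g) && (#|decoded g| == i))
    mass (t * c) (1 - t) A 0 g =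
  \sum_(i <= m < #|A|.+1) 'C(#|A|, m)%:R * t ^+ m * (1 - t) ^+ (#|A| - m)
    * \sum_(1 <= l < K.+1) ((#|A| - i)%:R / #|A|%:R * c ^+ i * (m ^_ i)%:R
        * stuck K c (m - i) l) *+ 'C(l.-1, i.-1).
Proof.
case: i => // i zA /= iA; rewrite (mass_card_decoded pq1) //.
under [in LHS]eq_bigr do rewrite stuck_thinning -sumrMnl.
rewrite exchange_big /= mulr_sumr -sumrMnl.
(* After this shift [m] counts the undecoded transmitters only; all transmitters number
   [m + i.+1]. *)
rewrite (big_addn 0 _ i.+1) big_mkord subSn //; apply: eq_bigr => m _.
rewrite !mulr_sumr -sumrMnl; apply: eq_bigr => l _.
rewrite addnK -subnDA [(i.+1 + m)%N]addnC.
have key : ((i.+1)`! * 'C(#|A|.-1, i.+1) * 'C(#|A| - i.+1, m))%:R =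
   (#|A| - i.+1)%:R / #|A|%:R * 'C(#|A|, m + i.+1)%:R * ((m + i.+1) ^_ i.+1)%:R :> R.
  have N0 : #|A|%:R != 0 :> R by rewrite pnatr_eq0 -lt0n; apply: leq_trans iA.
  apply: (mulfI N0); rewrite -natrM.
  have /= := @mul_bin_pred_trinomial #|A| (m + i.+1) i.+1 (leq_addl _ _).
  rewrite addnK => ->; rewrite !natrM; field; exact: N0.
move: ((1 - t) ^+ _) (stuck _ _ _ _) 'C(l.-1, _) => q Z Cl.
transitivity (((i.+1)`! * 'C(#|A|.-1, i.+1) * 'C(#|A| - i.+1, m))%:R *
   (t ^+ i.+1 * t ^+ m * c ^+ i.+1 * q * Z * Cl%:R)).
  move: (i.+1)`! 'C(#|A|.-1, i.+1) 'C(#|A| - i.+1, m) => a b d.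
  rewrite -(mulr_natr _ (a * b)) -(mulr_natr (_ *+ d)) -(mulr_natr _ d) !natrM exprMn.
  move: (t ^+ _) (t ^+ _) (c ^+ _) a%:R b%:R d%:R Cl%:R => *; ring.
rewrite key exprD -[in RHS](mulr_natr _ Cl).
move: (#|A|%:R^-1) (t ^+ _) (t ^+ _) (c ^+ _) (_ - _)%:R 'C(_, _)%:R (_ ^_ _)%:R Cl%:R.
by move=> *; ring.
Qed.
End Law.

From mathcomp Require Import all_classical all_reals all_analysis.
From mathcomp Require Import measurable_realfun.
Import Order.TTheory GRing.Theory Num.Theory numFieldNormedType.Exports.

Local Open Scope classical_set_scope.
Local Open Scope ring_scope.

(** * Vanishing probability of an infeasible level *)

Lemma measurable_gain_sq (R : realType) :
  measurable_fun setT (gain_sq : (R * R)%type -> R).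
Proof.
apply: measurable_funD; apply: measurable_funX.
  exact: measurable_fst.
exact: measurable_snd.
Qed.

Lemma complex_gaussian_set1 (R : realType) :
  complex_gaussian [set ((0 : R), (0 : R))] = 0%E.
Proof.
have -> : [set ((0 : R), (0 : R))] = [set 0] `*` [set 0].
  by apply/seteqP; split=> [_ -> //|[x y] /= [-> ->]].
rewrite /complex_gaussian product_measure1E; [|exact: measurable_set1..].
rewrite [X in (X * _)%E](_ : _ = 0%E) ?mul0e //.
have /null_content_dominatesP := @normal_prob_dominates R 0 (Num.sqrt 2^-1).
by apply=> //; exact: lebesgue_measure_set1.
Qed.

Lemma measurable_gain_sq_lt (R : realType) (d : measure_display)
    (Omega : measurableType d) (Pr : probability Omega R)
    (X : {RV Pr >-> (R * R)%type}) (P c : R) (b : bool) :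
  measurable [set w | (P * gain_sq (X w) < c) = b].
Proof.
have mX : measurable_fun setT (fun w => P * gain_sq (X w) < c).
  apply: measurable_fun_ltr => //; apply: measurable_funM => //.
  by apply: measurableT_comp; [exact: measurable_gain_sq|exact: measurable_funP].
have -> : [set w | (P * gain_sq (X w) < c) = b] =
    setT `&` (fun w => P * gain_sq (X w) < c) @^-1` [set b].
  by rewrite setTI.
exact: mX.
Qed.

(** Along the integers the events decrease, and their intersection lies in the null event of a zero
    gain. Continuity from above gives the limit; a real [P] is compared with its integer part. *)
Lemma gain_sq_small (R : realType) (d : measure_display)
    (Omega : measurableType d) (Pr : probability Omega R)
    (X : {RV Pr >-> (R * R)%type}) (c : R) :
  (forall A, measurable A -> distribution Pr X A = complex_gaussian A) ->
  Pr [set w | P * gain_sq (X w) < c] @[P --> +oo] --> 0%E.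
Proof.
move=> lawX.
pose F n : set Omega := [set w | n%:R * gain_sq (X w) < c].
have mF (P : R) : measurable [set w | P * gain_sq (X w) < c].
  exact: (measurable_gain_sq_lt _ _ _ true).
have gain_ge0 w : 0 <= gain_sq (X w) by rewrite addr_ge0 ?sqr_ge0.
have mFn n : measurable (F n) by exact: mF.
have m0 : measurable [set ((0 : R), (0 : R))].
  have -> : [set ((0 : R), (0 : R))] = [set 0] `*` [set 0].
    by apply/seteqP; split=> [_ -> //|[x y] /= [-> ->]].
  exact: measurableX.
have F0 : Pr (\bigcap_n F n) = 0%E.
  apply/eqP; rewrite eq_le measure_ge0 andbT.
  rewrite -(complex_gaussian_set1 R) -lawX //.
  apply: le_measure; rewrite ?inE.
  - exact: bigcapT_measurable.
  - by rewrite -[X in measurable X]setTI; exact: measurable_funP.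
  move=> w Fw; have gw0 : gain_sq (X w) = 0.
    apply/eqP; rewrite eq_le gain_ge0 andbT leNgt; apply/negP => gw.
    have := Fw (Num.truncn (c / gain_sq (X w))).+1 I; rewrite /F /=.
    rewrite -ltr_pdivlMr // => /lt_trans /(_ (truncnS_gt _)).
    by rewrite ltxx.
  move/eqP: gw0; rewrite paddr_eq0 ?sqr_ge0 // !sqrf_eq0 => /andP[/eqP h1 /eqP h2].
  by rewrite /= [X w]surjective_pairing h1 h2.
have Fcvg : Pr (F n) @[n --> \oo] --> 0%E.
  rewrite -F0; apply: nonincreasing_cvg_mu => //.
  - by rewrite (le_lt_trans (probability_le1 _ _)) ?ltry.
  - exact: bigcapT_measurable.
  - move=> m n mn; apply/subsetPset => w; rewrite /F /=; apply: le_lt_trans.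
    by rewrite ler_wpM2r // ler_nat.
have trunc_oo : Num.truncn P @[P --> (+oo : set_system R)] --> \oo.
  apply/cvgnyPge => n; near=> P; rewrite truncn_ge_nat; near: P.
    exact: nbhs_pinfty_ge.
  exact: nbhs_pinfty_ge.
apply: (@squeeze_cvge _ _ _ _ (cst 0%E) _ (fun P => Pr (F (Num.truncn P)))).
- near=> P; rewrite measure_ge0 /=; apply: le_measure; rewrite ?inE //.
  move=> w; rewrite /F /=; apply: le_lt_trans; rewrite ler_wpM2r //.
  rewrite truncn_le; near: P; exact: nbhs_pinfty_ge.
- exact: cvg_cst.
- exact: (cvg_comp _ _ trunc_oo Fcvg).
Unshelve. all: by end_near.
Qed.

(** [A] is a union of fibres of [X], which are countably many. This serves slot events, determined
    by levels, attempts and feasibility bits. *)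
Lemma measurable_saturated (d : measure_display) (Omega : measurableType d)
    (T : countType) (X : Omega -> T) (A : set Omega) :
  (forall t, measurable (X @^-1` [set t])) ->
  (forall w w', X w = X w' -> A w -> A w') -> measurable A.
Proof.
move=> mX satA.
have -> : A = \bigcup_(t in setT) (if `[< exists2 w, A w & X w = t >]
                                   then X @^-1` [set t] else set0).
  apply/seteqP; split=> [w Aw|w [t _]].
    by exists (X w) => //; case: asboolP => // -[]; exists w.
  by case: asboolP => // -[w' Aw' <-] /= /esym /satA; exact.
apply: countable_bigcupT_measurable => // t.
by case: ifP => _ //; exact: measurable0.
Qed.

(** * From the slot model to assignments of levels *)

Section SlotOutcome.
Context {R : realType}.
Variables (M K : nat) (rate : R) (silent : bool) (P : R) (D : {set 'I_M}).

Lemma eq_next_succeeded (gain gain' : 'I_M -> R * R) (level level' : 'I_M -> nat)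
    (attempt attempt' : 'I_M -> bool) :
  level =1 level' -> attempt =1 attempt' ->
  (forall u, infeasible M K rate P (gain u) (level u) =
             infeasible M K rate P (gain' u) (level' u)) ->
  next_succeeded K rate silent P D gain level attempt =
  next_succeeded K rate silent P D gain' level' attempt'.
Proof.
move=> eql eqa eqf.
have eqt k : transmitters K rate silent P D gain level attempt k =
    transmitters K rate silent P D gain' level' attempt' k.
  apply/setP => u; rewrite !inE eql eqa; case: eqP => [<-|]; last by rewrite !andbF.
  by rewrite -eqf eql.
rewrite /next_succeeded; congr (_ :|: _)%SET; apply/setP => u; rewrite !inE.
rewrite /succeeds eqf eql eqt; do 3![congr (_ && _)].
by apply: eq_all => k; rewrite eqt.
Qed.

(** With all chosen levels feasible, both values of [silent] give the same transmitters, and the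
    tests of [succeeds] become those of [decodedP]. *)
Lemma next_succeeded_feasible (gain : 'I_M -> R * R) (level : 'I_M -> nat)
    (attempt : 'I_M -> bool) (g : {ffun 'I_M -> 'I_K.+1}) :
  (forall u, ~~ infeasible M K rate P (gain u) (level u)) ->
  (forall u, g u = (if (u \notin D) && attempt u then level u else 0)%N :> nat) ->
  next_succeeded K rate silent P D gain level attempt = (D :|: decoded g)%SET.
Proof.
move=> feas gE.
(* Level 0 of [g] means idle, so the correspondence is limited to positive levels. *)
have tE k u : (0 < k)%N ->
    (u \in transmitters K rate silent P D gain level attempt k) = (g u == k :> nat).
  move=> k0; rewrite inE gE; case: (u \in D) => /=; first by rewrite eq_sym gtn_eqF.
  case: (attempt u) => /=; last by rewrite eq_sym gtn_eqF.
  by case: eqP => //= <-; rewrite feas implybT.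
rewrite /next_succeeded; congr (_ :|: _)%SET; apply/setP => u; rewrite [LHS]inE.
apply/idP/decodedP => [/and4P[/andP[l0 lK] _ /eqP tu /allP low]|[g0 dec]].
  have gu : g u = level u :> nat.
    by apply/eqP; rewrite -tE // tu set11.
  rewrite gu; split=> // v v' v0; rewrite leq_eqVlt => /predU1P[vu|vu] vv'.
    have : v \in [set u]%SET by rewrite -tu tE // vu.
    have : v' \in [set u]%SET by rewrite -tu tE // vv' vu.
    by rewrite !inE => /eqP -> /eqP ->.
  have := low (g v); rewrite mem_index_iota v0 vu => /(_ isT) /card_le1_eqP.
  by apply; rewrite tE // vv'.
have gu : g u = level u :> nat by move: g0; rewrite gE; case: ifP.
apply/and4P; split; rewrite -?gu ?g0 /=.
- by rewrite -ltnS.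
- by rewrite gu.
- apply/eqP/setP => v; rewrite tE // inE; apply/eqP/eqP => [vu|->//].
  by apply: dec => //; exact: val_inj.
- apply/allP => k; rewrite mem_index_iota => /andP[k0 ku].
  apply/card_le1_eqP => v v'; rewrite !tE // => /eqP vk /eqP v'k.
  apply: dec; [by rewrite ?vk ?v'k|by rewrite ?vk ?v'k ltnW|].
  by apply: val_inj; rewrite /= vk v'k.
Qed.

End SlotOutcome.

Lemma measure_finType_bigcup_le (d : measure_display) (Omega : measurableType d)
    (R : realType) (mu : {measure set Omega -> \bar R}) (I : finType)
    (F : I -> set Omega) : (forall i, measurable (F i)) ->
  (mu (\bigcup_i F i) <= \sum_i mu (F i))%E.
Proof.
move=> mF.
have -> : \bigcup_i F i = \big[setU/set0]_i F i.
  rewrite -bigcup_seq; congr bigcup.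
  by apply/seteqP; split=> // i _ /=; rewrite mem_index_enum.
suff [] : measurable (\big[setU/set0]_i F i) /\
  (mu (\big[setU/set0]_i F i) <= \sum_i mu (F i))%E by [].
apply: (big_rec2 (fun A s => measurable A /\ (mu A <= s)%E)) => [|i s A _ [mA As]].
  by rewrite measure0.
split; first exact: measurableU.
by rewrite (le_trans (measureU2 _ _ _)) // leeD2l.
Qed.

(** The bound covers every natural [k], since [level] may leave 1..K on a null event; truncated
    subtraction leaves finitely many values. *)
Lemma snr_level_bounded (R : realType) (M K : nat) (rate : R) :
  exists c, forall k, snr_level M K rate k <= c.
Proof.
exists (\sum_(n < K.+1) `|snr_rec M rate n|) => k; rewrite /snr_level.
have kK : (K - k < K.+1)%N by rewrite ltnS leq_subr.
rewrite (bigD1 (Ordinal kK)) //= (le_trans (ler_norm _)) // lerDl.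
exact: sumr_ge0.
Qed.

(** * Slot outcomes and the high-SNR limit *)

Section HighSNR.
Context (R : realType) (d : measure_display) (Omega : measurableType d)
  (Pr : probability Omega R) (M K : nat) (rate pTX pK : R) (silent : bool)
  (gain : 'I_M -> {RV Pr >-> (R * R)%type})
  (level : 'I_M -> {RV Pr >-> nat}) (attempt : 'I_M -> {RV Pr >-> bool}).
Hypothesis hpTX : 0 <= pTX <= 1.
Hypothesis KpK1 : pK *+ K = 1.
Hypothesis hgain : forall u A, measurable A ->
  distribution Pr (gain u) A = complex_gaussian A.
Hypothesis hlevel : forall u k, (1 <= k <= K)%N ->
  distribution Pr (level u) [set k] = pK%:E.
Hypothesis hattempt : forall u A,
  distribution Pr (attempt u) A = bernoulli_prob pTX A.
Hypothesis hindep : slot_independent gain level attempt.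
Variable D : {set 'I_M}.
Implicit Types g : {ffun 'I_M -> 'I_K.+1}.

(* The pairs (level, attempt) with effective level [v] that have positive
   probability form the rectangle [level_set u v] x [attempt_set u v]. *)
Definition level_set (u : 'I_M) (v : 'I_K.+1) : set nat :=
  if u \in D then (if v == ord0 then setT else set0)
  else if v == ord0 then setT else [set (v : nat)].

Definition attempt_set (u : 'I_M) (v : 'I_K.+1) : set bool :=
  if u \in D then setT else [set v != ord0].

(** The vacuous constraint on the gains gives the event the shape required by [slot_independent]. *)
Definition outcome g : set Omega := \bigcap_(u in [set: 'I_M])
  (gain u @^-1` setT `&` level u @^-1` level_set u (g u)
   `&` attempt u @^-1` attempt_set u (g u)).

Lemma outcomeP g w u : outcome g w ->
  g u = (if (u \notin D) && attempt u w then level u w else 0)%N :> nat.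
Proof.
move=> /(_ u I) [[_]]; rewrite /level_set /attempt_set /=.
case: (u \in D) => /=; first by case: eqP => // ->.
by case: eqVneq => [->|gu] lu /= -> //.
Qed.

Lemma measurable_RV_preimage (dT : measure_display) (T : measurableType dT)
  (X : {RV Pr >-> T}) (A : set T) : measurable A -> measurable (X @^-1` A).
Proof. by move=> mA; rewrite -[X in measurable X]setTI; exact: measurable_funP. Qed.

Lemma measurable_outcome g : measurable (outcome g).
Proof.
apply: fin_bigcap_measurable => // u _.
by apply: measurableI; [apply: measurableI|]; exact: measurable_RV_preimage.
Qed.

Lemma prob_outcome g :
  Pr (outcome g) = (mass (pTX * pK) (1 - pTX) (~: D) 0 g)%:E.
Proof.
rewrite hindep // /mass -prodEFin; apply: eq_bigr => u _.
rewrite preimage_setT probability_setT mul1e /wt inE /level_set /attempt_set.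
have lE k : (0 < k <= K)%N -> Pr (level u @^-1` [set k]) = pK%:E.
  by move=> /(hlevel u).
have aE b : Pr (attempt u @^-1` [set b]) = (if b then pTX else 1 - pTX)%:E.
  by have := hattempt u [set b]; rewrite /bernoulli_prob hpTX fsbig_set1.
case: (u \in D) => /=.
  rewrite preimage_setT probability_setT mule1.
  by case: eqP => _; rewrite ?preimage_setT ?preimage_set0 ?probability_setT ?measure0.
rewrite aE; case: eqVneq => [_|gu] /=.
  by rewrite preimage_setT probability_setT mul1e.
have g0 : (0 < g u)%N by rewrite lt0n.
have guK : (g u <= K)%N by rewrite -ltnS ltn_ord.
by rewrite lE ?g0 // -EFinM mulrC.
Qed.

Lemma prob_outcomes (S : {pred {ffun 'I_M -> 'I_K.+1}}) :
  Pr (\bigcup_(g in [set` S]) outcome g) =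
  (\sum_(g in S) mass (pTX * pK) (1 - pTX) (~: D) 0 g)%:E.
Proof.
have -> : [set` S] = [set` enum S].
  by apply/seteqP; split=> g /=; rewrite mem_enum.
rewrite measure_fin_bigcup //=.
- rewrite -fsbig_seq ?enum_uniq // big_enum -sumEFin.
  by apply: eq_bigr => g _; exact: prob_outcome.
- move=> g g' _ _ [w [gw g'w]]; apply/ffunP => u; apply: val_inj.
  by rewrite /= (outcomeP u gw) (outcomeP u g'w).
- by move=> g _; exact: measurable_outcome.
Qed.

(** [hlevel] speaks of 1..K only; as the assignments have total mass 1, the event that none of them
    describes the slot is null. *)
Lemma prob_outcomeT : Pr (\bigcup_g outcome g) = 1%E.
Proof.
have := prob_outcomes predT; rewrite (mass_total _ (~: D) (leq0n K)).
  by rewrite mulr0n subr0 expr1n => <-; congr (Pr (bigcup _ _)); apply/seteqP; split.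
by rewrite -mulrnAr KpK1 mulr1 subrK.
Qed.

Lemma measurable_next_succeeded P (Q : {pred {set 'I_M}}) :
  measurable [set w | Q (next_succeeded K rate silent P D (gain ^~ w)
                          (level ^~ w) (attempt ^~ w))].
Proof.
pose X w : {ffun 'I_M -> nat * bool * bool} := [ffun u =>
  (level u w, attempt u w, infeasible M K rate P (gain u w) (level u w))].
apply: (@measurable_saturated _ _ _ X) => [t|w w' /ffunP XE].
  have -> : X @^-1` [set t] = \bigcap_(u in [set: 'I_M])
     (level u @^-1` [set (t u).1.1] `&` attempt u @^-1` [set (t u).1.2] `&`
      [set w | (P * gain_sq (gain u w) < snr_level M K rate (t u).1.1) = (t u).2]).
    apply/seteqP; split=> [w <- u _ /=|w tw]; first by rewrite !ffunE.
    apply/ffunP => u; rewrite ffunE; have [[/= l a] f] := tw u I.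
    by rewrite /infeasible l a f -!surjective_pairing.
  apply: fin_bigcap_measurable => // u _.
  apply: measurableI; last exact: measurable_gain_sq_lt.
  by apply: measurableI; exact: measurable_RV_preimage.
rewrite /=; congr (is_true (_ \in Q)); apply: eq_next_succeeded => u;
  by have := XE u; rewrite !ffunE => -[].
Qed.

(** Unless some [P * gain_sq] is below the common threshold [c], the new state is read off the
    assignment. The transition probability is thus within [e P] of the limit, and a squeeze
    concludes. *)
Lemma trans_prob_cvg (hM : (0 < M)%N) i :
  trans_prob K rate hM silent gain level attempt P D i @[P --> +oo] -->
  (\sum_(g : {ffun 'I_M -> 'I_K.+1} | chain_state hM (D :|: decoded g) == i)
     mass (pTX * pK) (1 - pTX) (~: D) 0 g)%:E.
Proof.
have [c cP] := snr_level_bounded M K rate.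
pose bad P u : set Omega := [set w | P * gain_sq (gain u w) < c].
pose S := [pred g : {ffun 'I_M -> 'I_K.+1} | chain_state hM (D :|: decoded g) == i].
rewrite -(prob_outcomes S); set l := Pr _.
pose e P : \bar R := (\sum_u Pr (bad P u))%E.
have mbad P u : measurable (bad P u) by exact: (measurable_gain_sq_lt _ _ _ true).
have e0 : e P @[P --> +oo] --> 0%E.
  have zero : (\sum_(u < M) (0 : \bar R))%E = 0%E by rewrite big1.
  rewrite -zero.
  apply: cvg_nnesum => u _; first by near=> P.
  exact: (gain_sq_small _ (hgain u)).
pose A P : set Omega := [set w | chain_state hM (next_succeeded K rate silent P D
  (gain ^~ w) (level ^~ w) (attempt ^~ w)) = i].
have mA P : measurable (A P).
  rewrite (_ : A P = [set w | [pred E | chain_state hM E == i] (next_succeeded K rate silent P D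
  (gain ^~ w) (level ^~ w) (attempt ^~ w))]); first exact: measurable_next_succeeded.
  by apply/seteqP; split=> w /= /eqP.
have mU (B : {pred _}) : measurable (\bigcup_(g in [set` B]) outcome g).
  by apply: fin_bigcup_measurable => // g _; exact: measurable_outcome.
have mB P : measurable (\bigcup_u bad P u) by apply: fin_bigcup_measurable.
have good P g w : outcome g w -> ~ (\bigcup_u bad P u) w ->
    next_succeeded K rate silent P D (gain ^~ w) (level ^~ w) (attempt ^~ w) =
    (D :|: decoded g)%SET.
  move=> gw nbad; apply: next_succeeded_feasible => u; last exact: outcomeP.
  apply/negP => inf; apply: nbad; exists u => //.
  exact: lt_le_trans inf (cP _).
have UA P : (l <= Pr (A P) + e P)%E.
  apply: (@le_trans _ _ (Pr (A P `|` \bigcup_u bad P u))).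
    apply: le_measure; rewrite ?inE //; first exact: measurableU.
    move=> w [g /eqP gi gw]; have [|nbad] := pselect ((\bigcup_u bad P u) w); first by right.
    by left; rewrite /A /= (good _ _ _ gw nbad).
  rewrite (le_trans (measureU2 _ _ _)) // leeD2l //.
  exact: measure_finType_bigcup_le.
have AU P : (Pr (A P) <= l + e P)%E.
  apply: (@le_trans _ _ (Pr ((\bigcup_(g in [set` S]) outcome g `|` \bigcup_u bad P u)
                          `|` ~` \bigcup_g outcome g))).
    apply: le_measure; rewrite ?inE //.
      apply: measurableU; first exact: measurableU (mU S) (mB P).
      by apply: measurableC; apply: fin_bigcup_measurable => // g _; exact: measurable_outcome.
    move=> w Aw; have [[g _ gw]|] := pselect ((\bigcup_g outcome g) w); last by right.
    left; have [|nbad] := pselect ((\bigcup_u bad P u) w); first by right.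
    by left; exists g => //=; rewrite inE /= -(good _ _ _ gw nbad); exact/eqP.
  have null : Pr (~` \bigcup_g outcome g) = 0%E.
    rewrite probability_setC ?prob_outcomeT ?subee //.
    by apply: fin_bigcup_measurable => // g _; exact: measurable_outcome.
  rewrite (le_trans (measureU2 _ _ _)) //.
  - exact: measurableU (mU S) (mB P).
  - by apply: measurableC; apply: fin_bigcup_measurable => // g _; exact: measurable_outcome.
  rewrite [X in (_ + X <= _)%E](_ : _ = 0%E); last exact: null.
  have mUS := mU S.
  rewrite adde0 (le_trans (measureU2 _ _ _)) // leeD2l //.
  exact: measure_finType_bigcup_le.
have lfin : l \is a fin_num by exact: fin_num_measure.
have efin P : e P \is a fin_num.
  by apply/sum_fin_numP => u _ _; exact: fin_num_measure.
apply: (@squeeze_cvge _ _ _ _ (fun P => l - e P)%E _ (fun P => l + e P)%E).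
- by near=> P; apply/andP; split; [rewrite leeBlDr ?efin //; exact: UA|exact: AU].
- rewrite -[X in _ --> X]sube0.
  by apply: (cvgeB (f := cst l) (g := e)); [exact: fin_num_adde_defr|exact: cvg_cst|exact: e0].
- rewrite -[X in _ --> X]adde0.
  by apply: (cvgeD (f := cst l) (g := e)); [exact: fin_num_adde_defr|exact: cvg_cst|exact: e0].
Unshelve. all: by end_near.
Qed.

End HighSNR.

(** * Transition probabilities of the chain *)

(** The bound [#|D| + i < M] excludes the index [M], reserved for success of the tagged user.
    Decoded sets of nonzero mass avoid [D], so cardinalities add. *)
Lemma chain_state_mass (R : comPzRingType) (M K : nat) (hM : (0 < M)%N) (p q : R)
    (D : {set 'I_M}) (i : nat) :
  Ordinal hM \notin D -> (#|D| + i < M)%N ->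
  \sum_(g : {ffun 'I_M -> 'I_K.+1} | chain_state hM (D :|: decoded g) == (#|D| + i)%N)
     mass p q (~: D) 0 g =
  \sum_(g : {ffun 'I_M -> 'I_K.+1} | (Ordinal hM \notin decoded g) && (#|decoded g| == i))
     mass p q (~: D) 0 g.
Proof.
move=> zD DiM.
rewrite big_mkcond [RHS]big_mkcond; apply: eq_bigr => g _.
have [gD|/mass_not_subset ->] := boolP (decoded g \subset ~: D); last by rewrite !if_same.
rewrite /chain_state inE (negbTE zD) /=; case: (_ \in decoded g) => /=.
  by rewrite gtn_eqF.
have DI : D :&: decoded g = finset.set0.
  by apply/eqP; rewrite finset.setI_eq0 disjoint_sym finset.disjoints_subset.
by rewrite cardsU DI cards0 subn0 eqn_add2l.
Qed.

Theorem lemma1 (R : realType) (d : measure_display) (Omega : measurableType d)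
    (Pr : probability Omega R) (M K : nat) (hM : (0 < M)%N) (hK : (0 < K)%N)
    (rate : R) (hrate : 0 < rate)
    (pTX : R) (hpTX : 0 <= pTX <= 1) (pK : R) (hpK : pK = 1 / K%:R)
    (silent : bool)
    (gain : 'I_M -> {RV Pr >-> (R * R)%type})
    (level : 'I_M -> {RV Pr >-> nat})
    (attempt : 'I_M -> {RV Pr >-> bool})
    (hgain : forall u A, measurable A ->
       distribution Pr (gain u) A = complex_gaussian A)
    (hlevel : forall u k, (1 <= k <= K)%N ->
       distribution Pr (level u) [set k] = pK%:E)
    (hattempt : forall u A,
       distribution Pr (attempt u) A = bernoulli_prob pTX A)
    (hindep : slot_independent gain level attempt) :
  let trans P D i := trans_prob K rate hM silent gain level attempt P D i in
  (* (i) *)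
  (forall (j : nat) (D : {set 'I_M}), (j <= M - 1)%N -> chain_state hM D = j ->
     trans P D j @[P --> +oo] -->
     (1 - \sum_(1 <= m < (M - j).+1)
            'C(M - j, m)%:R * pTX ^+ m * (1 - pTX) ^+ (M - j - m)
            * \sum_(1 <= k < K.+1) m%:R * pK * (1 - k%:R * pK) ^+ (m - 1))%:E)
  /\
  (* (ii) *)
  (forall (j : nat) (D : {set 'I_M}), (j + 2 <= M)%N -> chain_state hM D = j ->
     trans P D (j + 1)%N @[P --> +oo] -->
     ((M - j)%:R * pTX * (1 - pTX) ^+ (M - j - 1)
        * ((M - j - 1)%:R / (M - j)%:R) * K%:R * pK
      + \sum_(2 <= m < (M - j).+1)
          'C(M - j, m)%:R * pTX ^+ m * (1 - pTX) ^+ (M - j - m)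
          * \sum_(1 <= k < K)
              (M - j - 1)%:R / (M - j)%:R * m%:R * pK
              * ((1 - k%:R * pK) ^+ (m - 1)
                 - \sum_(k.+1 <= kappa < K.+1)
                     (m - 1)%:R * pK * (1 - kappa%:R * pK) ^+ (m - 2)))%:E)
  /\
  (* (iii) *)
  (forall (j i : nat) (D : {set 'I_M}), (j + 3 <= M)%N ->
     (2 <= i <= minn (M - 1 - j) K)%N -> chain_state hM D = j ->
     trans P D (j + i)%N @[P --> +oo] -->
     ('C(M - j, i)%:R * pTX ^+ i * (1 - pTX) ^+ (M - j - i)
        * \sum_(1 <= k1 < (K - i + 1).+1) \sum_(k1 + i - 1 <= k2 < K.+1)
            (M - j - i)%:R / (M - j)%:R * pK ^+ i
            * 'C(k2 - k1 - 1, i - 2)%:R * \prod_(1 <= p < i.+1) p%:R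
      + \sum_(i.+1 <= m < (M - j).+1)
          'C(M - j, m)%:R * pTX ^+ m * (1 - pTX) ^+ (M - j - m)
          * \sum_(1 <= k1 < (K - i).+1) \sum_(k1 + i - 1 <= k2 < K)
              (M - j - i)%:R / (M - j)%:R * pK ^+ i
              * 'C(k2 - k1 - 1, i - 2)%:R
              * \prod_(0 <= p < i) (m - p)%:R
              * ((1 - k2%:R * pK) ^+ (m - i)
                 - \sum_(k2.+1 <= kappa < K.+1)
                     (m - i)%:R * pK * (1 - kappa%:R * pK) ^+ (m - i - 1)))%:E).
Proof.
have K0 : K%:R != 0 :> R by rewrite pnatr_eq0 -lt0n.
have KpK1 : pK *+ K = 1 by rewrite hpK -[LHS]mulr_natr divfK.
move=> trans.
(* As [j < M], the tagged user is not in [D]: its success would give the state [M]. *)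
have lim j i (D : {set 'I_M}) : (j + i < M)%N -> chain_state hM D = j ->
    Ordinal hM \in ~: D /\ #|~: D| = (M - j)%N /\
    trans P D (j + i)%N @[P --> +oo] -->
      (\sum_(g : {ffun 'I_M -> 'I_K.+1} |
          (Ordinal hM \notin decoded g) && (#|decoded g| == i))
         mass (pTX * pK) (1 - pTX) (~: D) 0 g)%:E.
  move=> jM; rewrite /chain_state; case: ifPn => [_ E|zD Dj].
    by move: jM; rewrite -E ltnNge leq_addr.
  split; first by rewrite inE.
  split; first by rewrite cardsCs finset.setCK card_ord Dj.
  rewrite -Dj -chain_state_mass // ?Dj //.
  exact: (trans_prob_cvg rate silent hpTX KpK1 hgain hlevel hattempt hindep).
split; [|split].
- move=> j D jM Dj.
  have := lim j 0%N D; rewrite addn0 => /(_ _ Dj)[|zD [DM]]; first by lia.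
  by rewrite decoded0_law // DM.
- move=> j D jM Dj.
  have [|zD [DM]] := lim j 1%N D _ Dj; first by lia.
  rewrite decoded_law // DM; last by lia.
  (* For [m = 1] no undecoded transmitter is left, so [stuck] is 1 and each of the [K] levels
     contributes equally. *)
  rewrite big_ltn ?ltnS; last by lia.
  congr (_ --> (_ + _)%:E).
    rewrite bin1 expr1 (eq_bigr (fun=> (M - j - 1)%:R / (M - j)%:R * pK)).
      rewrite sumr_const_nat subSS subn0 -[X in _ * X = _]mulr_natr.
      move: (_ ^+ _) (_^-1) => q Ni; ring.
    by move=> l _; rewrite bin0 stuck0 ffactn1 !mulr1 expr1.
  apply: eq_big_nat => m /andP[m2 mM]; congr (_ * _).
  (* For [m >= 2] the undecoded transmitters have no level above [K], so the last term drops. *)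
  rewrite big_nat_recr //= stuck_top //; last by lia.
  rewrite mulr0 mul0rn addr0; apply: eq_big_nat => k _.
  rewrite bin0 mulr1n stuckE expr1 ffactn1 -[(m - 1 - 1)%N]subnDA.
  by congr (_ * _); rewrite mulrAC.
- move=> j i D jM iM Dj.
  have [|zD [DM]] := lim j i D _ Dj; first by lia.
  rewrite decoded_law // DM; last by lia.
  rewrite [X in X%:E]big_ltn ?ltnS; last by lia.
  have prodE m : \prod_(0 <= p < i) (m - p)%:R = (m ^_ i)%:R :> R.
    by rewrite ffact_prod big_mkord natr_prod.
  have factE : \prod_(1 <= p < i.+1) p%:R = (i ^_ i)%:R :> R.
    by rewrite ffactnn fact_prod natr_prod.
  congr (_ --> (_ + _)%:E).
    congr (_ * _).
    (* For [m = i] the last decoded level may be [K], so [sum_two_levels] is used with [n = K.+1];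
       for [m > i] it is used with [n = K]. *)
    have -> : (K - i + 1).+1 = (K.+1 - i).+1 by lia.
    rewrite -sum_two_levels; last by lia.
    apply: eq_bigr => k1 _; apply: eq_bigr => k2 _.
    by rewrite subnn stuck0 factE mulr1 -[LHS]mulr_natr mulrAC.
  apply: eq_big_nat => m /andP[im mM]; congr (_ * _).
  rewrite big_nat_recr //= stuck_top //; last by lia.
  rewrite mulr0 mul0rn addr0 -sum_two_levels; last by lia.
  apply: eq_bigr => k1 _; apply: eq_bigr => k2 _.
  by rewrite stuckE prodE -[LHS]mulr_natr mulrAC; congr (_ * _); rewrite mulrAC.
Qed.
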